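(* Let $\tilde g:{S_k}^n\to\mathbb{R}$ be a Potts $k$-submodular function, $N$ the associated network, and for each $\alpha\in\{1,\dots,k\}$ let $G_\alpha$ and $(\Sigma_\alpha,\le_\alpha)$ be the residual graph and the poset defined from a maximum $\alpha$-flow. Let $P=\bigcup_{\alpha=1}^k\Sigma_\alpha\times\{\alpha\}$, let $\le$ be the partial order on $P$ given by $(X,\alpha)\le(Y,\beta)$ iff $\alpha=\beta$ and $X\le_\alpha Y$, and let $\overset{\bullet}{\smile}$ be the symmetric relation on $P$ given by $(X,\alpha)\overset{\bullet}{\smile}(Y,\beta)$ iff $\alpha\ne\beta$ and $X=Y$. Then the triplet $(P,\le,\overset{\bullet}{\smile})$ is an elementary PIP with minimal inconsistency relation $\overset{\bullet}{\smile}$. The consistent ideal family $\mathcal{C}(P)$ and the family of minimum admissible semi-multicuts of $N$ are in one-to-one correspondence by the map $$I\mapsto(X_0^I,X_1^I,\dots,X_k^I),$$ where, for each $\alpha\in\{1,\dots,k\}$, $X_\alpha^I$ is the admissible $\alpha$-cut whose set of vertices in $V$ consists of all $i\in V$ such that $i$ is reachable from $s_\alpha$ in $G_\alpha$ or belongs to $X$ for some $(X,\alpha)\in I$, and $X_0^I=\tilde V\setminus\bigcup_{\alpha=1}^kX_\alpha^I$.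
   Context: $k$-submodularity. $S_k=\{0,\dots,k\}$ with $a\preceq b$ iff $a\in\{0,b\}$, and ${S_k}^n$ has the componentwise order. $x\sqcap y$, $x\sqcup y$ are componentwise $\min$, $\max$ with respect to $\preceq$ when $x_i,y_i$ are comparable, and $0$ otherwise. $f$ is $k$-submodular if $f(x)+f(y)\ge f(x\sqcap y)+f(x\sqcup y)$ for all $x,y$. Potts $k$-submodular function. $(V,E)$ is a connected undirected graph, $V=\{1,\dots,n\}$, with positive edge weights $\lambda_{i,j}$, and $\tilde g(x)=\sum_i\tilde g_i(x_i)+\sum_{\{i,j\}\in E}\lambda_{i,j}d(x_i,x_j)$, where each $\tilde g_i:S_k\to\mathbb{R}$ is $k$-submodular and $d(a,b)=1$ if $0\ne a\ne b\ne0$, $0$ if $a=b$, $1/2$ otherwise. Network $N=(\tilde V,\tilde E,c)$ (undirected). For each $i$ choose a minimizer $\gamma_i\in S_k$ of $\tilde g_i$, and put $\mu_i=2(\tilde g_i(0)-\tilde g_i(\gamma_i))\ge0$ and $\sigma_{i,\alpha}=\tilde g_i(\alpha)-2\tilde g_i(0)+\tilde g_i(\gamma_i)$ for $\alpha\in\{1,\dots,k\}$. Start from $(V,E)$ with $c(\{i,j\})=\lambda_{i,j}$. Add new vertices $s_1,\dots,s_k$ (terminals). For each $i$ with $\mu_i>0$ (then $\gamma_i\neq0$), add an edge $\{i,s_{\gamma_i}\}$ of capacity $\mu_i$. For each $i$ and $\alpha\in\{1,\dots,k\}$ with $\sigma_{i,\alpha}>0$, add a new vertex $i^\alpha$ (the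 $\alpha$-fringe of $i$) and an edge $\{i,i^\alpha\}$ of capacity $2\sigma_{i,\alpha}$. $\tilde V$ is the set of all vertices (of $V$, terminals, fringes), $\tilde E$ the set of all edges. Cuts. For $X\subseteq\tilde V$, $c(X)$ is the sum of $c(e)$ over edges $e$ between $X$ and $\tilde V\setminus X$. An $\alpha$-cut is $X\subseteq\tilde V$ with $s_\alpha\in X$, $s_\beta\notin X$ for $\beta\ne\alpha$, and containing no $\alpha$-fringe. It is admissible if for each $\beta\neq\alpha$ ($\beta\in\{1,\dots,k\}$), each $\beta$-fringe $i^\beta$ belongs to $X$ if and only if $i\in X$. A semi-multicut is an ordered partition $\mathcal{X}=(X_0,X_1,\dots,X_k)$ of $\tilde V$ ($X_0$ may be empty) such that $X_\alpha$ is an $\alpha$-cut for each $\alpha\in\{1,\dots,k\}$; its capacity is $c(\mathcal{X})=\frac12\sum_{\alpha=1}^kc(X_\alpha)$. It is admissible if for each $\alpha\in\{1,\dots,k\}$ each $\alpha$-fringe $i^\alpha$ belongs to $X_0$ if $i\in X_0\cup X_\alpha$, and to $X_\beta$ if $i\in X_\beta$ with $\beta\in\{1,\dots,k\}\setminus\{\alpha\}$. A minimum admissible semi-multicut is an admissible semi-multicut of minimum capacity. Posets $\Sigma_\alpha$. $\overrightarrow N$ is obtained from $N$ by replacing each edge $\{u,v\}$ by directed edges $(u,v)$ and $(v,u)$, each of capacity $c(\{u,v\})$. For each $\alpha$, take the network obtained from $\overrightarrow N$ by removing all $\beta$-fringes with $\beta\ne\alpha$ and contracting all terminals $s_\beta$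 ($\beta\ne\alpha$) and all $\alpha$-fringes into a single terminal $s'$; $G_\alpha$ is the residual graph of a maximum $(s_\alpha,s')$-flow $\phi$ in it (edges: directed edges $a$ with $\phi(a)<c(a)$, and reverses of edges with $\phi(a)>0$). $\Sigma_\alpha$ is the set of strongly connected components of $G_\alpha$ that are neither reachable from $s_\alpha$ nor reachable to $s'$, with $X\le_\alpha Y$ iff $X$ is reachable from $Y$ in $G_\alpha$. Elements of $\Sigma_\alpha$ are subsets of $V$. PIPs. A PIP may be given as a triple $(P,\le,\overset{\bullet}{\smile})$ with $(P,\le)$ a finite poset and $\overset{\bullet}{\smile}$ a symmetric relation (the minimal inconsistency relation) such that (MIC1) if $p\overset{\bullet}{\smile}q$ there is no $r$ with $p\le r$, $q\le r$; (MIC2) if $p'\le p$, $q'\le q$, $p'\overset{\bullet}{\smile}q'$ and $p\overset{\bullet}{\smile}q$, then $p'=p$, $q'=q$. Pairs with $p\overset{\bullet}{\smile}q$ are the minimally inconsistent pairs. An ideal (down-closed subset, possibly empty) is consistent if it contains no minimally inconsistent pair; $\mathcal{C}(P)$ is the family of consistent ideals. $P$ is elementary if: (EP0) $P$ is the disjoint union of (possibly empty) sets $P_1,\dots,P_l$ such that every pair $\{x,y\}$ of distinct elements is minimally inconsistent iff $\{x,y\}\subseteq P_i$ for some $i$; (EP1) for distinct $i,j$, if $|P_i|\ge2$ and $P_j=\{y\}$, there is no $x\in P_i$ with $x<y$; (EP2) for distinct $i,j$ with $|P_i|,|P_j|\ge2$, either (EP2-1) every pair of $x\in P_i$, $y\in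 P_j$ is not comparable, or (EP2-2) there exist $x^\circ\in P_i$, $y^\circ\in P_j$ with $x^\circ<y$ and $y^\circ<x$ for all $x\in P_i\setminus\{x^\circ\}$, $y\in P_j\setminus\{y^\circ\}$. *)

(* Defs.v *)
(* [R : realType] plays the role of the real numbers. *)
From mathcomp Require Import all_boot all_order all_algebra.
From mathcomp Require Import reals.

Set Implicit Arguments.
Unset Strict Implicit.
Unset Printing Implicit Defensive.

Import Order.TTheory GRing.Theory Num.Theory.
Local Open Scope ring_scope.

(* S_k = {0, ..., k}.  The nonzero labels 1, ..., k are indexed by ['I_k]:
   [a : 'I_k] stands for the label [lab a] of value [a + 1]. *)
Notation Sk k := 'I_k.+1.
Notation lab a := (lift ord0 a).

Section KSubmodular.
Context (R : realType) (k : nat).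

Definition sk_le (a b : Sk k) : bool := (a == ord0) || (a == b).

Definition sk_meet (a b : Sk k) : Sk k :=
  if sk_le a b then a else if sk_le b a then b else ord0.

Definition sk_join (a b : Sk k) : Sk k :=
  if sk_le a b then b else if sk_le b a then a else ord0.

Definition ksubmodular (n : nat) (f : {ffun 'I_n -> Sk k} -> R) : Prop :=
  forall x y : {ffun 'I_n -> Sk k},
    f [ffun i => sk_meet (x i) (y i)] + f [ffun i => sk_join (x i) (y i)]
      <= f x + f y.

Definition potts_dist (a b : Sk k) : R :=
  if a == b then 0 else if (a != ord0) && (b != ord0) then 1 else 2^-1.

Definition potts_sum (n : nat) (e : rel 'I_n) (lam : 'I_n -> 'I_n -> R)
    (g : 'I_n -> Sk k -> R) (x : {ffun 'I_n -> Sk k}) : R :=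
  \sum_i g i (x i)
  + \sum_(i < n) \sum_(j < n | (i < j)%N && e i j)
      lam i j * potts_dist (x i) (x j).

Record potts_ksubmodular (n : nat) (e : rel 'I_n) (lam : 'I_n -> 'I_n -> R)
    (g : 'I_n -> Sk k -> R) (gt : {ffun 'I_n -> Sk k} -> R) : Prop := {
  potts_edge_irr : irreflexive e;
  potts_edge_sym : symmetric e;
  potts_edge_connected : forall i j, connect e i j;
  potts_weight_sym : forall i j, lam i j = lam j i;
  potts_weight_gt0 : forall i j, e i j -> 0 < lam i j;
  potts_unary : forall i,
    ksubmodular (fun x : {ffun 'I_1 -> Sk k} => g i (x ord0));
  potts_eq : forall x, gt x = potts_sum e lam g x
}.

End KSubmodular.

(* Flows in a finite directed multigraph with vertices [W] and arcs [A]. *)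
Section Flow.
Context (R : realType) (W A : finType) (tl hd : A -> W) (c : A -> R) (s t : W).

Definition is_flow (phi : A -> R) : Prop :=
  (forall a, 0 <= phi a <= c a) /\
  (forall w, w != s -> w != t ->
     \sum_(a | hd a == w) phi a = \sum_(a | tl a == w) phi a).

Definition flow_value (phi : A -> R) : R :=
  \sum_(a | tl a == s) phi a - \sum_(a | hd a == s) phi a.

Definition max_flow (phi : A -> R) : Prop :=
  is_flow phi /\ forall psi, is_flow psi -> flow_value psi <= flow_value phi.

Definition residual (phi : A -> R) : rel W := fun u v =>
  [exists a, [&& tl a == u, hd a == v & phi a < c a]
          || [&& tl a == v, hd a == u & 0 < phi a]].

End Flow.

Section PIP.
Context (T : finType) (le mic : rel T).

Definition is_PIP : Prop :=
  [/\ [/\ reflexive le, antisymmetric le & transitive le],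
      symmetric mic,
      (* MIC1 *)
      forall p q, mic p q -> ~ exists r, le p r /\ le q r
    & (* MIC2 *)
      forall p q p' q', le p' p -> le q' q -> mic p' q' -> mic p q ->
        p' = p /\ q' = q].

Definition consistent_ideal (I : {set T}) : Prop :=
  (forall p q, q \in I -> le p q -> p \in I) /\
  (forall p q, p \in I -> q \in I -> ~~ mic p q).

Definition pip_lt : rel T := fun x y => (x != y) && le x y.

Definition EP0 (l : nat) (B : 'I_l -> {set T}) : Prop :=
  (forall x, exists! i, x \in B i) /\
  (forall x y, x != y -> (mic x y <-> exists i, x \in B i /\ y \in B i)).

Definition EP1 (l : nat) (B : 'I_l -> {set T}) : Prop :=
  forall i j y, i != j -> (2 <= #|B i|)%N -> B j = [set y]%SET ->
    ~ exists x, x \in B i /\ pip_lt x y.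

Definition EP2 (l : nat) (B : 'I_l -> {set T}) : Prop :=
  forall i j, i != j -> (2 <= #|B i|)%N -> (2 <= #|B j|)%N ->
    (forall x y, x \in B i -> y \in B j -> ~~ le x y /\ ~~ le y x)
    \/ (exists x0 y0, [/\ x0 \in B i, y0 \in B j
        & forall x y, x \in B i -> x != x0 -> y \in B j -> y != y0 ->
            pip_lt x0 y /\ pip_lt y0 x]).

Definition elementary : Prop :=
  exists (l : nat) (B : 'I_l -> {set T}), [/\ EP0 B, EP1 B & EP2 B].

End PIP.

Section Network.
Context (R : realType) (k n : nat) (e : rel 'I_n) (lam : 'I_n -> 'I_n -> R).
Context (g : 'I_n -> Sk k -> R) (gamma : 'I_n -> Sk k).

Definition mu (i : 'I_n) : R := 2 * (g i ord0 - g i (gamma i)).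

Definition sigma (i : 'I_n) (a : 'I_k) : R :=
  g i (lab a) - 2 * g i ord0 + g i (gamma i).

Definition fringe : finType := {p : 'I_n * 'I_k | 0 < sigma p.1 p.2}.

Definition fbase (f : fringe) : 'I_n := (val f).1.
Definition flabel (f : fringe) : 'I_k := (val f).2.

(* Vertices of the network: original vertices, terminals, fringes. *)
Definition nvertex : finType := ('I_n + 'I_k + fringe)%type.

Definition orig (i : 'I_n) : nvertex := inl (inl i).
Definition term (a : 'I_k) : nvertex := inl (inr a).
Definition frng (f : fringe) : nvertex := inr f.

(* Edges have positive capacity, so the edges are exactly the pairs on which
   [cap] is nonzero; recall that [mu i >= 0], and [mu i = 0] means no edge. *)
Definition cap (u v : nvertex) : R :=
  match u, v with
  | inl (inl i), inl (inl j) => if e i j then lam i j else 0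
  | inl (inl i), inl (inr a) | inl (inr a), inl (inl i) =>
      if gamma i == lab a then mu i else 0
  | inl (inl i), inr f | inr f, inl (inl i) =>
      if fbase f == i then 2 * sigma i (flabel f) else 0
  | _, _ => 0
  end.

Definition cut_cap (X : {set nvertex}) : R :=
  \sum_(u in X) \sum_(v in ~: X) cap u v.

Definition is_cut (a : 'I_k) (X : {set nvertex}) : Prop :=
  [/\ term a \in X,
      forall b, b != a -> term b \notin X
    & forall f, flabel f = a -> frng f \notin X].

Definition admissible_cut (a : 'I_k) (X : {set nvertex}) : Prop :=
  is_cut a X /\
  forall f, flabel f != a -> (frng f \in X <-> orig (fbase f) \in X).

Definition semi_multicut (X : {ffun Sk k -> {set nvertex}}) : Prop :=
  (forall v, exists! j, v \in X j) /\ (forall a : 'I_k, is_cut a (X (lab a))).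

Definition smc_cap (X : {ffun Sk k -> {set nvertex}}) : R :=
  2^-1 * \sum_(a < k) cut_cap (X (lab a)).

Definition admissible_smc (X : {ffun Sk k -> {set nvertex}}) : Prop :=
  semi_multicut X /\
  forall f : fringe,
    (orig (fbase f) \in X ord0 :|: X (lab (flabel f)) -> frng f \in X ord0) /\
    (forall b : 'I_k, b != flabel f ->
       orig (fbase f) \in X (lab b) -> frng f \in X (lab b)).

Definition min_admissible_smc (X : {ffun Sk k -> {set nvertex}}) : Prop :=
  admissible_smc X /\ forall Y, admissible_smc Y -> smc_cap X <= smc_cap Y.

(* Contracted network of label [a]: its vertices are V, the source s_a and the
   sink s' into which the other terminals and the a-fringes are contracted.
   Its arcs are the arcs of the bidirected network between vertices that are
   not removed, so parallel arcs created by the contraction stay distinct. *)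
Definition cvertex : finType := ('I_n + bool)%type.
Definition csource : cvertex := inr true.
Definition csink : cvertex := inr false.

Definition contract (a : 'I_k) (u : nvertex) : cvertex :=
  match u with
  | inl (inl i) => inl i
  | inl (inr b) => if b == a then csource else csink
  | inr _ => csink
  end.

Definition kept (a : 'I_k) (u : nvertex) : bool :=
  if u is inr f then flabel f == a else true.

Definition narc (a : 'I_k) : finType :=
  {uv : nvertex * nvertex |
    [&& kept a uv.1, kept a uv.2 & 0 < cap uv.1 uv.2]}.

Definition arc_tail a (x : narc a) : cvertex := contract a (val x).1.
Definition arc_head a (x : narc a) : cvertex := contract a (val x).2.
Definition arc_cap a (x : narc a) : R := cap (val x).1 (val x).2.

Definition max_label_flow (a : 'I_k) (phi : narc a -> R) : Prop :=
  max_flow (@arc_tail a) (@arc_head a) (@arc_cap a) csource csink phi.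

Context (phi : forall a : 'I_k, narc a -> R).

Definition Gres (a : 'I_k) : rel cvertex :=
  residual (@arc_tail a) (@arc_head a) (@arc_cap a) (phi (a := a)).

(* [reach a u v]: v is reachable from u in G_a. *)
Definition reach (a : 'I_k) : rel cvertex := connect (Gres a).

Definition scc (a : 'I_k) (i : 'I_n) : {set 'I_n} :=
  [set j | reach a (inl i) (inl j) && reach a (inl j) (inl i)]%SET.

(* The components in question contain neither s_a nor s', hence are given by
   their vertices in V. *)
Definition Sigma (a : 'I_k) : {set {set 'I_n}} :=
  [set scc a i | i : 'I_n &
     ~~ reach a csource (inl i) && ~~ reach a (inl i) csink]%SET.

Definition Sigma_le (a : 'I_k) (X Y : {set 'I_n}) : bool :=
  [exists x in X, [exists y in Y, reach a (inl y) (inl x)]].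

Definition pip : finType := {p : {set 'I_n} * 'I_k | p.1 \in Sigma p.2}.

Definition pip_le : rel pip := fun p q =>
  ((val p).2 == (val q).2) && Sigma_le (val p).2 (val p).1 (val q).1.

Definition pip_mic : rel pip := fun p q =>
  ((val p).2 != (val q).2) && ((val p).1 == (val q).1).

(* The admissible a-cut whose set of vertices in V is A; see [to_cutP]. *)
Definition to_cut (a : 'I_k) (A : {set 'I_n}) : {set nvertex} :=
  [set u | match u with
           | inl (inl i) => i \in A
           | inl (inr b) => b == a
           | inr f => (flabel f != a) && (fbase f \in A)
           end]%SET.

Lemma to_cutP (a : 'I_k) (A : {set 'I_n}) (X : {set nvertex}) :
  (admissible_cut a X /\ forall i, (orig i \in X) = (i \in A))
  <-> X = to_cut a A.
Proof.
split=> [[[[ta tb fa] adm] XA]|->].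
  apply/setP=> -[[i|b]|f]; rewrite inE /=.
  - exact: XA.
  - by case: eqVneq => [->|/tb/negbTE].
  - case: eqVneq => [/fa/negbTE//|/adm fX] /=.
    by rewrite -XA; apply/idP/idP => /fX.
split; last by move=> i; rewrite inE.
split; first split.
- by rewrite inE /= eqxx.
- by move=> b ba; rewrite inE.
- by move=> f fa; rewrite inE /= fa eqxx.
- by move=> f fa; rewrite !inE /= fa.
Qed.

Definition ideal_cut (I : {set pip}) (a : 'I_k) : {set nvertex} :=
  to_cut a [set i | reach a csource (inl i)
              || [exists p in I, ((val p).2 == a) && (i \in (val p).1)]]%SET.

(* The tuple (X_0, X_1, ..., X_k) associated with the ideal I. *)
Definition ideal_smc (I : {set pip}) : {ffun Sk k -> {set nvertex}} :=
  [ffun j : Sk k => if unlift ord0 j is Some a then ideal_cut I a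
                    else ~: (\bigcup_(a < k) ideal_cut I a)%SET].

End Network.

(* Main.v *)
Require Import Defs.
From mathcomp Require Import all_boot all_order all_algebra.
From mathcomp Require Import reals lra.

(** The theorem reduces, by max-flow min-cut, to a combinatorial statement about
    the minimizers of the cut functions [label_cut a], one for each label.

    Fix a label [a].  Since [phi a] is a maximum flow, a set [A] of original
    vertices minimizes [label_cut a] exactly when [A] plus the source is closed
    under the arcs of the residual graph ([min_cut_residual_closed]); such an
    [A] is called stable ([optimal_stable]).  So a stable set is the part
    reachable from the source together with a down-closed union of members of
    [Sigma a], and the ideals of [Sigma a] are in bijection with the stable
    sets.

    Different labels interact through one fact only, [stableD]: if [A] is stable
    for [a] and [B] is stable for [b] with [a != b], then [A :\: B] is stable
    for [a].  It follows from the posimodularity of undirected cuts,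
    [label_cut_posimodular]: replacing [A] and [B] by [A :\: B] and [B :\: A] does
    not increase the sum of the two cuts, and neither cut can get below its
    minimum, so both differences are minimizers again.  Consequences:
    - [A] avoids everything reachable from the source of [b], because removing
      [A] from the least stable set of [b] leaves a stable set of [b]
      ([stable_not_src]);
    - a component of label [a] that meets [B] lies inside [B], because [A :\: B]
      is closed under reachability ([scc_sub_stable]);
    - hence where stable sets of two labels meet, the two components coincide
      ([scc_label_eq]), so disjointness of the parts is the same as consistency
      of the ideal;
    - no component is strictly below the same component in two labels
      ([below_two_labels], which gives MIC2);
    - if [X] is below [Y] in label [a] and [X] also occurs in label [b], then
      [Y] occurs in label [b], below [X] ([label_swap]).  This gives EP1, and two
      applications exclude a third label, which gives EP2.

    An admissible semi-multicut amounts to pairwise disjoint sets of original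
    vertices, one for each label, and its capacity is half the sum of their
    label cuts.  The least stable sets of the labels are pairwise disjoint, so
    the minimum is reached exactly when every part is stable on its own
    ([min_admissible_smcP]). *)

Set Implicit Arguments.
Unset Strict Implicit.
Unset Printing Implicit Defensive.
Import Order.TTheory GRing.Theory Num.Theory.
Local Open Scope ring_scope.

(** * Maximum flows and minimum cuts *)

Section MaxFlow.
Context (R : realType) (W A : finType) (tl hd : A -> W) (c : A -> R) (s t : W).

Definition net_outflow (psi : A -> R) (w : W) : R :=
  \sum_(a | tl a == w) psi a - \sum_(a | hd a == w) psi a.

Lemma net_outflowD (psi chi : A -> R) w :
  net_outflow (fun a => psi a + chi a) w = net_outflow psi w + net_outflow chi w.
Proof. by rewrite /net_outflow !big_split /= opprD addrACA. Qed.

Lemma net_outflowZ x (psi : A -> R) w :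
  net_outflow (fun a => x * psi a) w = x * net_outflow psi w.
Proof. by rewrite /net_outflow -!mulr_sumr mulrBr. Qed.

Lemma net_outflow_arc b w :
  net_outflow (fun a => (a == b)%:R) w = (tl b == w)%:R - (hd b == w)%:R.
Proof.
have sum1 (h : A -> W) : \sum_(a | h a == w) (a == b)%:R = (h b == w)%:R :> R.
  rewrite (eq_bigr (fun a => if a == b then 1 else 0)); last first.
    by move=> a _; case: eqP.
  rewrite -big_mkcondr /=; case: eqP => [hb|hb].
    rewrite (big_pred1 b) // => a /=; case: (eqVneq a b) => [->|_].
      by rewrite hb eqxx.
    by rewrite andbF.
  rewrite big_pred0 // => a.
  by case: (eqVneq a b) => [->|_]; [case: eqP | rewrite andbF].
by rewrite /net_outflow !sum1.
Qed.

(** A residual path is turned into a perturbation of the flow that sends one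
    unit along it.  The admissible perturbations form a convex cone, so the units of
    the successive arcs may be added even if the path repeats or cancels arcs,
    and the path need not be made simple. *)
Lemma residual_path_net_outflow (phi : A -> R) u v :
  connect (residual tl hd c phi) u v ->
  exists psi : A -> R,
    (forall a, (0 < psi a -> phi a < c a) /\ (psi a < 0 -> 0 < phi a)) /\
    forall w, net_outflow psi w = (u == w)%:R - (v == w)%:R.
Proof.
case/connectP => p; elim: p u => [|x p IH] u /=.
  move=> _ ->; exists (fun=> 0); split; first by move=> a; rewrite ltxx.
  by move=> w; rewrite /net_outflow !big1 // !subrr.
case/andP => ux /IH xv /xv[psi [psiP psiE]].
have [chi [chiP chiE]] : exists chi : A -> R,
    (forall a, (0 < chi a -> phi a < c a) /\ (chi a < 0 -> 0 < phi a)) /\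
    forall w, net_outflow chi w = (u == w)%:R - (x == w)%:R.
  have /existsP[b /orP[]/and3P[/eqP<- /eqP<- phib]] := ux.
    exists (fun a => (a == b)%:R); split; last by move=> w; rewrite net_outflow_arc.
    by move=> a; rewrite ltr0n ltrn0; case: eqP => [->|].
  exists (fun a => -1 * (a == b)%:R); split; last first.
    by move=> w; rewrite net_outflowZ net_outflow_arc; lra.
  move=> a; rewrite mulN1r oppr_gt0 oppr_lt0 ltr0n ltrn0.
  by case: eqP => [->|].
exists (fun a => psi a + chi a); split=> [a|w]; last first.
  by rewrite net_outflowD psiE chiE; lra.
have [psi1 psi2] := psiP a; have [chi1 chi2] := chiP a; split=> ab.
  have [/psi1//|psi_le0] := ltP 0 (psi a); apply: chi1; lra.
have [/psi2//|psi_ge0] := ltP (psi a) 0; apply: chi2; lra.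
Qed.

Lemma feasible_step (phi psi : A -> R) :
  (forall a, 0 <= phi a <= c a) ->
  (forall a, (0 < psi a -> phi a < c a) /\ (psi a < 0 -> 0 < phi a)) ->
  exists2 x : R, 0 < x & forall a, 0 <= phi a + x * psi a <= c a.
Proof.
move=> phi_bd psi_dir.
pose room a : R := if 0 < psi a then (c a - phi a) / psi a
                   else if psi a < 0 then phi a / - psi a else 1.
have room_gt0 a : 0 < room a.
  rewrite /room; case: (ltP 0 (psi a)) => [psi_gt0|_].
    by rewrite divr_gt0 // subr_gt0; apply: (psi_dir a).1.
  case: (ltP (psi a) 0) => // psi_lt0; rewrite divr_gt0 ?oppr_gt0 //.
  exact: (psi_dir a).2.
exists (\big[Num.min/1]_a room a).
  by elim/big_ind: _ => // x y x0 y0; rewrite lt_min x0.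
move=> a; set x := \big[_/_]_a _.
have x_ge0 : 0 <= x.
  by apply: le_bigmin => // b _; apply: ltW.
have : x <= room a by apply: bigmin_le.
have /andP[phi_ge0 phi_le] := phi_bd a.
rewrite /room; case: (ltP 0 (psi a)) => [psi_gt0|psi_le0].
  rewrite ler_pdivlMr // => xpsi.
  by apply/andP; split; [rewrite addr_ge0 // mulr_ge0 // ltW | lra].
case: (ltP (psi a) 0) => [psi_lt0|psi_ge0 _].
  rewrite ler_pdivlMr ?oppr_gt0 // mulrN => xpsi.
  have : 0 <= x * - psi a by rewrite mulr_ge0 // oppr_ge0.
  by rewrite mulrN => ?; apply/andP; split; lra.
have -> : psi a = 0 by apply/eqP; rewrite eq_le psi_le0.
by rewrite mulr0 addr0 phi_ge0.
Qed.

(** Otherwise a small multiple of the unit sent along the path could be added. *)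
Lemma max_flow_no_augmenting_path (phi : A -> R) :
  s != t -> max_flow tl hd c s t phi ->
  ~~ connect (residual tl hd c phi) s t.
Proof.
move=> st [[phi_bd phi_cons] phi_max].
apply/negP => /residual_path_net_outflow[psi [psi_dir psiE]].
have [x x_gt0 x_bd] := feasible_step phi_bd psi_dir.
have net_outflowE w :
    net_outflow (fun a => phi a + x * psi a) w
      = net_outflow phi w + x * ((s == w)%:R - (t == w)%:R).
  by rewrite net_outflowD net_outflowZ psiE.
have /phi_max : is_flow tl hd c s t (fun a => phi a + x * psi a).
  split=> // w ws wt; apply/esym/eqP; rewrite -subr_eq0.
  rewrite -[X in X == 0]/(net_outflow (fun a => phi a + x * psi a) w) net_outflowE.
  rewrite ![_ == w]eq_sym (negbTE ws) (negbTE wt) subrr mulr0 addr0.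
  by rewrite /net_outflow phi_cons // subrr.
have := net_outflowE s; rewrite /net_outflow /flow_value => ->.
by rewrite eqxx eq_sym (negbTE st) subr0 mulr1; lra.
Qed.

Definition arc_cut (S : {set W}) : R :=
  \sum_(a | (tl a \in S) && (hd a \notin S)) c a.

(** How far an arc is from attaining equality in weak duality for the cut [S]:
    the unused capacity of an arc that leaves [S], the flow of an arc that
    enters it. *)
Definition slack (phi : A -> R) (S : {set W}) (a : A) : R :=
  if (tl a \in S) && (hd a \notin S) then c a - phi a
  else if (tl a \notin S) && (hd a \in S) then phi a else 0.

Lemma slack_ge0 (phi : A -> R) S a :
  is_flow tl hd c s t phi -> 0 <= slack phi S a.
Proof.
case=> /(_ a)/andP[? ?] _; rewrite /slack.
by case: ifP => _; [rewrite subr_ge0 | case: ifP].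
Qed.

(** Weak duality with its exact defect: summing the conservation law over [S]
    expresses the flow value as the net flow across the cut. *)
Lemma arc_cutE (phi : A -> R) (S : {set W}) :
  is_flow tl hd c s t phi -> s \in S -> t \notin S ->
  arc_cut S = flow_value tl hd s phi + \sum_a slack phi S a.
Proof.
move=> [_ phi_cons] sS tS.
have -> : flow_value tl hd s phi = \sum_(w in S) net_outflow phi w.
  rewrite (bigD1 s) //= big1 ?addr0 // => w /andP[wS ws].
  rewrite /net_outflow phi_cons ?subrr //.
  by apply: contraNneq tS => <-.
have sum_fibers (h : A -> W) :
    \sum_(w in S) \sum_(a | h a == w) phi a = \sum_a (h a \in S)%:R * phi a.
  rewrite (exchange_big_dep predT) //=.
  rewrite [LHS](eq_bigr (fun a => (h a \in S)%:R * phi a)) // => a _.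
  case: (boolP (h a \in S)) => [haS|haS].
    rewrite mul1r (big_pred1 (h a)) // => w /=.
    by case: (eqVneq (h a) w) => [<-|];
      rewrite ?haS ?andbF ?andbT // eq_sym => /negbTE.
  rewrite mul0r big_pred0 // => w.
  by case: (eqVneq (h a) w) => [<-|]; rewrite ?(negbTE haS) ?andbF.
rewrite sumrB !sum_fibers -sumrB -big_split /= /arc_cut big_mkcond /=.
apply: eq_bigr => a _; rewrite /slack.
by case: (tl a \in S); case: (hd a \in S) => /=; lra.
Qed.

(** A cut is closed in the residual graph iff it has no slack.  The set reachable
    from the source is such a cut, so the minimum cuts are those without
    slack. *)
Lemma min_cut_residual_closed (phi : A -> R) (S : {set W}) :
  s != t -> max_flow tl hd c s t phi -> s \in S -> t \notin S ->
  (forall T : {set W}, s \in T -> t \notin T -> arc_cut S <= arc_cut T) <->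
  (forall u v, u \in S -> residual tl hd c phi u v -> v \in S).
Proof.
move=> st phi_max sS tS; have phi_flow := phi_max.1.
have slack0 (T : {set W}) :
    (forall u v, u \in T -> residual tl hd c phi u v -> v \in T) ->
    \sum_a slack phi T a = 0.
  move=> Tcl; apply: big1 => a _; have /andP[phi_ge0 phi_le] := phi_flow.1 a.
  rewrite /slack; case: ifP => [/andP[tT hT]|_].
    apply/eqP; rewrite subr_eq0 eq_le phi_le andbT leNgt.
    apply: contra hT => lt_phi; apply: (Tcl (tl a)) => //.
    by apply/existsP; exists a; rewrite !eqxx lt_phi.
  case: ifP => // /andP[tT hT]; apply/eqP; rewrite eq_le phi_ge0 andbT leNgt.
  apply: contra tT => gt_phi; apply: (Tcl (hd a)) => //.
  by apply/existsP; exists a; rewrite !eqxx gt_phi orbT.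
split=> [Smin|Scl T sT tT]; last first.
  rewrite (arc_cutE phi_flow sS tS) (arc_cutE phi_flow sT tT) slack0 // addr0.
  by rewrite lerDl sumr_ge0 // => a _; apply: slack_ge0.
pose T := [set v | connect (residual tl hd c phi) s v]%SET.
have sT : s \in T by rewrite inE connect0.
have tT : t \notin T by rewrite inE max_flow_no_augmenting_path.
have slackT : \sum_a slack phi T a = 0.
  apply: slack0 => u v; rewrite !inE => su uv.
  exact: connect_trans su (connect1 uv).
have := Smin T sT tT.
rewrite (arc_cutE phi_flow sS tS) (arc_cutE phi_flow sT tT) slackT.
rewrite addr0 gerDl => slack_le0.
have : \sum_a slack phi S a == 0.
  by rewrite eq_le slack_le0 sumr_ge0 // => a _; apply: slack_ge0.
rewrite psumr_eq0 => [/allP slackS|a _]; last exact: slack_ge0.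
move=> u v uS /existsP[a /orP[]/and3P[/eqP ta /eqP ha phia]];
  apply: contraTT isT => vS;
  have := slackS a (mem_index_enum _); rewrite /slack ta ha uS (negbTE vS) /=.
  by rewrite subr_eq0 gt_eqF.
by rewrite gt_eqF.
Qed.

End MaxFlow.

(** * Cuts of the network and stable sets *)

Section Cuts.
Context (R : realType) (k n : nat) (e : rel 'I_n) (lam : 'I_n -> 'I_n -> R)
  (g : 'I_n -> Sk k -> R) (gt : {ffun 'I_n -> Sk k} -> R)
  (hg : potts_ksubmodular e lam g gt)
  (gamma : 'I_n -> Sk k)
  (hgamma : forall (i : 'I_n) (a : Sk k), g i (gamma i) <= g i a).
Implicit Types (a b : 'I_k) (A B : {set 'I_n}).

Local Notation vertex := (nvertex g gamma).

Lemma cap_ge0 (u v : vertex) : 0 <= cap e lam u v.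
Proof.
have mu_ge0 i : 0 <= mu g gamma i by rewrite mulr_ge0 // subr_ge0 hgamma.
have sigma_ge0 (f : fringe g gamma) : 0 <= 2 * sigma g gamma (fbase f) (flabel f).
  by rewrite mulr_ge0 // ltW // (valP f).
case: u v => [[i|a]|f] [[j|b]|f'] //=; case: ifP => //.
- by move/(potts_weight_gt0 hg)/ltW.
- by move/eqP <-.
- by move/eqP <-.
Qed.

Lemma capC (u v : vertex) : cap e lam u v = cap e lam v u.
Proof.
case: u v => [[i|a]|f] [[j|b]|f'] //=.
by rewrite (potts_edge_sym hg) (potts_weight_sym hg).
Qed.

Definition label_cut a A : R := cut_cap e lam (to_cut g gamma a A).

Lemma cut_cap_pairs (X : {set vertex}) :
  cut_cap e lam X
    = \sum_(p : vertex * vertex | (p.1 \in X) && (p.2 \notin X)) cap e lam p.1 p.2.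
Proof.
rewrite /cut_cap pair_big_dep /=; apply: eq_bigl => p /=.
by rewrite inE.
Qed.

(** In the symmetric form, posimodularity holds for each edge separately. *)
Lemma cut_cap_sym (X : {set vertex}) :
  cut_cap e lam X *+ 2
    = \sum_u \sum_v ((u \in X) != (v \in X))%:R * cap e lam u v.
Proof.
have -> : cut_cap e lam X
    = \sum_u \sum_v ((u \in X) && (v \notin X))%:R * cap e lam u v.
  rewrite /cut_cap big_mkcond /=; apply: eq_bigr => u _.
  case: (u \in X) => /=; last by rewrite big1 // => v _; rewrite mul0r.
  rewrite big_mkcond /=; apply: eq_bigr => v _; rewrite inE.
  by case: (v \in X) => /=; rewrite ?mul1r ?mul0r.
rewrite mulr2n {2}exchange_big /= -big_split /=; apply: eq_bigr => u _.
rewrite -big_split /=; apply: eq_bigr => v _; rewrite [cap e lam v u]capC -mulrDl.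
by congr (_ * _); case: (u \in X); case: (v \in X); rewrite /= ?addr0 ?add0r.
Qed.

(** For an edge between original vertices this is the posimodularity of
    undirected cuts.  At least one of the two given cuts separates a vertex of
    [A :&: B] from a given terminal, whose label is not both [a] and [b], and at
    most one of the two new cuts does.  A fringe is separated from its base only
    by the cut of its own label, when that cut contains the base; shrinking the
    cut makes this rarer. *)
Lemma label_cut_posimodular a b A B : a != b ->
  label_cut a (A :\: B) + label_cut b (B :\: A) <= label_cut a A + label_cut b B.
Proof.
move=> ab; rewrite -(@ler_pMn2r _ 2) // !mulrnDl !cut_cap_sym -!big_split /=.
apply: ler_sum => u _; rewrite -!big_split /=; apply: ler_sum => v _.
rewrite -!mulrDl -!natrD.
have [->|cap_neq0] := eqVneq (cap e lam u v) 0; first by rewrite !mulr0.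
rewrite ler_wpM2r ?cap_ge0 // ler_nat.
have if_neq0 (x : R) (q : bool) : (if q then x else 0) != 0 -> q.
  by case: q => //; rewrite eqxx.
have label_excl d : ~~ ((d == a) && (d == b)).
  by apply: contra ab => /andP[/eqP <-].
case: u v cap_neq0 => [[i|c]|f] [[j|d]|f'] /=; rewrite ?eqxx // =>
  /if_neq0 uv; rewrite !inE /=.
- by case: (i \in A); case: (i \in B); case: (j \in A); case: (j \in B).
- move: (label_excl d).
  by case: (d == a); case: (d == b); case: (i \in A); case: (i \in B).
- rewrite !(eqP uv); move: (label_excl (flabel f')).
  by case: (flabel f' == a); case: (flabel f' == b); case: (i \in A); case: (i \in B).
- move: (label_excl c).
  by case: (c == a); case: (c == b); case: (j \in A); case: (j \in B).
rewrite !(eqP uv); move: (label_excl (flabel f)).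
by case: (flabel f == a); case: (flabel f == b); case: (j \in A); case: (j \in B).
Qed.

Definition optimal a A : Prop := forall B, label_cut a A <= label_cut a B.

(** [A] and [B] being optimal, the inequality of [label_cut_posimodular] must be
    tight in each of its two terms. *)
Lemma optimalD a b A B : a != b -> optimal a A -> optimal b B -> optimal a (A :\: B).
Proof.
move=> ab Aopt Bopt C; have := label_cut_posimodular A B ab.
have := Aopt C; have := Bopt (B :\: A); lra.
Qed.

Definition source_side A : {set cvertex n} :=
  [set w | match w with inl i => i \in A | inr b => b end].

(** The removed fringes carry a label other than [a], so [to_cut] puts them on the
    side of their base vertex and their edges are not cut. *)
Lemma arc_cut_source_side a A :
  arc_cut (@arc_tail R k n e lam g gamma a) (@arc_head R k n e lam g gamma a)
     (@arc_cap R k n e lam g gamma a) (source_side A) = label_cut a A.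
Proof.
have contractE (u : vertex) : kept a u ->
    (contract a u \in source_side A) = (u \in to_cut g gamma a A).
  case: u => [[i|b]|f] /=; rewrite !inE //=; first by case: eqP.
  by move=> ->.
pose F (p : vertex * vertex) := cap e lam p.1 p.2.
pose X := to_cut g gamma a A.
pose K (p : vertex * vertex) := [&& kept a p.1, kept a p.2 & 0 < F p].
have removedE (u v : vertex) :
    ~~ kept a u -> cap e lam u v != 0 -> (u \in X) = (v \in X).
  case: u => // f /= fa; case: v => [[i|b]|f'] /=; try by rewrite eqxx.
  by case: (eqVneq (fbase f) i) => [<- _|]; [rewrite !inE fa | rewrite eqxx].
rewrite /label_cut cut_cap_pairs -/X.
rewrite (bigID K) /= [X in _ + X]big1 ?addr0; last first.
  move=> p /andP[/andP[p1 p2]]; rewrite /K -/(F p) => nK; apply/eqP.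
  apply: contraNT nK => Fp; rewrite lt_def Fp cap_ge0 !andbT.
  apply/andP; split; apply: contraNT p2 => unkept.
    by rewrite -(removedE p.1).
  by rewrite (removedE p.2 p.1) // capC.
rewrite [RHS](eq_bigl (fun p => (p \in K) && ((p.1 \in X) && (p.2 \notin X))));
  last first.
  by move=> p; rewrite andbC.
rewrite (big_sub_cond K (fun p => (p.1 \in X) && (p.2 \notin X)) F).
apply/esym; apply: eq_big => [[[u v] uvK]|//] /=; case/and3P: (uvK) => uk vk _.
by rewrite /arc_tail /arc_head /= !contractE.
Qed.

Context (phi : forall a, narc e lam g gamma a -> R)
  (hphi : forall a, max_label_flow (phi a)).

Local Notation src a i := (reach phi a (csource n) (inl i)).
Local Notation snk a i := (reach phi a (inl i) (csink n)).
Local Notation "i ~>_ a j" := (reach phi a (inl i) (inl j))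
  (at level 45, a at level 2, no associativity, format "i  ~>_ a  j").

Definition stable a A : Prop :=
  [/\ forall i, src a i -> i \in A,
      forall i, i \in A -> ~~ snk a i
    & forall i j, i \in A -> i ~>_a j -> j \in A].

Lemma source_not_reach_sink a : ~~ reach phi a (csource n) (csink n).
Proof. exact: max_flow_no_augmenting_path (hphi a). Qed.

(** Stability is closedness of [source_side A] under the residual arcs, read on
    the original vertices. *)
Lemma optimal_stable a A : optimal a A <-> stable a A.
Proof.
have srcA B : csource n \in source_side B by rewrite inE.
have snkA B : csink n \notin source_side B by rewrite inE.
have [min_closed closed_min] :=
  min_cut_residual_closed (isT : csource n != csink n) (hphi a) (srcA A) (snkA A).
split=> [Aopt|[Asrc Asnk Acl]].
  have Acl u v : u \in source_side A -> reach phi a u v -> v \in source_side A.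
    move=> uA /connectP[p]; elim: p u uA => [|w p IH] u uA /=; first by move=> _ ->.
    case/andP=> uw; apply: IH; apply: min_closed uA uw => T sT tT.
    have -> : T = source_side [set i | inl i \in T].
      apply/setP => -[i|[]]; rewrite !inE //; exact/negbTE.
    by rewrite !arc_cut_source_side; apply: Aopt.
  split=> [i si|i iA|i j iA ij].
  - by have := Acl _ _ (srcA A) si; rewrite inE.
  - apply/negP => it; have := Acl (inl i) _ _ it.
    by rewrite (negbTE (snkA A)) inE => /(_ iA).
  - by have := Acl (inl i) _ _ ij; rewrite !inE => /(_ iA).
move=> B; rewrite -!arc_cut_source_side; apply: closed_min => // u v.
case: u => [i|[]]; case: v => [j|[]]; rewrite !inE // => iA /connect1 uv.
- exact: Acl iA uv.
- by have := Asnk i iA; rewrite /reach uv.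
- exact: Asrc.
- by have := source_not_reach_sink a; rewrite /reach uv.
Qed.

(** The only link between the residual graphs of different labels. *)
Lemma stableD a b A B : a != b -> stable a A -> stable b B -> stable a (A :\: B).
Proof. by rewrite -!optimal_stable; apply: optimalD. Qed.

(** * Strong components of different labels *)

(** The vertices that lie in the components collected in [Sigma a]. *)
Definition inner a i := ~~ src a i && ~~ snk a i.

(** The least stable set that contains [i], as soon as there is one. *)
Definition closure_from a i : {set 'I_n} := [set j | src a j || i ~>_a j].

Lemma reach_refl a i : i ~>_a i.
Proof. exact: connect0. Qed.

Lemma reach_trans a u v w : reach phi a u v -> reach phi a v w -> reach phi a u w.
Proof. exact: connect_trans. Qed.

Lemma mem_scc a i : i \in scc phi a i.
Proof. by rewrite inE reach_refl. Qed.

Lemma scc_eq a i j : j \in scc phi a i -> scc phi a j = scc phi a i.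
Proof.
rewrite inE => /andP[ij ji]; apply/setP => l; rewrite !inE.
apply/andP/andP => -[/= h1 h2]; split.
- exact: reach_trans ij h1.
- exact: reach_trans h2 ji.
- exact: reach_trans ji h1.
- exact: reach_trans h2 ij.
Qed.

Lemma inner_scc a i j : inner a i -> j \in scc phi a i -> inner a j.
Proof.
move=> /andP[si ti]; rewrite inE => /andP[ij ji]; apply/andP; split.
  by apply: contra si => sj; apply: reach_trans sj ji.
by apply: contra ti => tj; apply: reach_trans ij tj.
Qed.

Lemma stable_src a : stable a [set i | src a i].
Proof.
split=> [i|i|i j]; rewrite !inE //; last exact: reach_trans.
move=> si; apply/negP => it; have /negP[] := source_not_reach_sink a.
exact: reach_trans si it.
Qed.

Lemma stable_closure_from a i : ~~ snk a i -> stable a (closure_from a i).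
Proof.
have [_ srcN srcC] := stable_src a.
move=> ti; split=> [j|j|j l]; rewrite !inE.
- by move=> ->.
- case/orP => [sj|ij]; first by apply: srcN; rewrite inE.
  by apply: contra ti => tj; apply: reach_trans ij tj.
- case/orP => [sj|ij] jl.
    by have := srcC j l; rewrite !inE => ->.
  by rewrite (reach_trans ij jl) orbT.
Qed.

Lemma stable_closure_from_proper a i :
  inner a i -> stable a (closure_from a i :\: scc phi a i).
Proof.
case/andP=> si ti; have [cS cN cC] := stable_closure_from ti.
split=> [j sj|j|j l]; rewrite !in_setD.
- rewrite cS // andbT inE; apply: contra si => /andP[_].
  exact: reach_trans sj.
- by case/andP => _; apply: cN.
case/andP=> jS jC jl; rewrite (cC j) // andbT.
apply: contra jS; rewrite !inE => /andP[il li]; rewrite (reach_trans jl li) andbT.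
move: jC; rewrite inE => /orP[sj|//]; have /negP[] := si.
exact: reach_trans sj (reach_trans jl li).
Qed.

(** Removing [A] from the least stable set of label [b] leaves a stable set of
    label [b], so nothing was removed. *)
Lemma stable_not_src a b A i : a != b -> stable a A -> i \in A -> ~~ src b i.
Proof.
rewrite eq_sym => ba Ast iA; have [cS _ _] := stableD ba (stable_src b) Ast.
by apply/negP => /cS; rewrite in_setD iA.
Qed.

Lemma stable_meet_inner a b A B i : a != b -> stable a A -> stable b B ->
  i \in A -> i \in B -> inner a i.
Proof.
move=> ab Ast Bst iA iB; rewrite /inner (stable_not_src _ Bst iB) 1?eq_sym //.
by case: Ast => _ ->.
Qed.

Lemma inner_closure_from a i : inner a i -> i \in closure_from a i.
Proof. by rewrite inE reach_refl orbT. Qed.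

(** If [j] is in the component of [i] but not in [B], then the stable set
    [closure_from a i :\: B] contains [j] and hence [i], which is reachable
    from [j]. *)
Lemma scc_sub_stable a b i B : a != b -> inner a i -> stable b B -> i \in B ->
  scc phi a i \subset B.
Proof.
move=> ab /andP[_ ti] Bst iB; apply/subsetP => j; rewrite inE => /andP[ij ji].
apply: contraTT iB => jB.
have [_ _ cC] := stableD ab (stable_closure_from ti) Bst.
have /cC/(_ ji) : j \in closure_from a i :\: B by rewrite !inE ij orbT andbT.
by rewrite in_setD => /andP[].
Qed.

(** For [j] in the component of label [a], [scc_sub_stable] applied to
    [closure_from b i] gives a path of label [b] from [i] to [j], and applied to
    [closure_from b j] it gives one from [j] to [i]. *)
Lemma scc_label_sub a b i : a != b -> inner a i -> inner b i ->
  scc phi a i \subset scc phi b i.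
Proof.
move=> ab ai bi; apply/subsetP => j ji.
have ast := stable_closure_from (andP ai).2.
have bst := stable_closure_from (andP bi).2.
have jB : j \in closure_from b i.
  exact: subsetP (scc_sub_stable ab ai bst (inner_closure_from bi)) _ ji.
have jA : j \in closure_from a i.
  by move: ji; rewrite !inE => /andP[-> _]; rewrite orbT.
have bj : inner b j by apply: stable_meet_inner bst ast jB jA; rewrite eq_sym.
have aj : inner a j := inner_scc ai ji.
have iBj : i \in closure_from b j.
  have bjst := stable_closure_from (andP bj).2.
  apply: subsetP (scc_sub_stable ab aj bjst (inner_closure_from bj)) _ _.
  by rewrite (scc_eq ji) mem_scc.
move: jB iBj; rewrite !inE (negbTE (andP bj).1) (negbTE (andP bi).1) /=.
by move=> -> ->.
Qed.

Lemma scc_label_eq a b i : inner a i -> inner b i -> scc phi a i = scc phi b i.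
Proof.
have [-> //|ab] := eqVneq a b => ai bi; apply/eqP.
by rewrite eqEsubset !scc_label_sub // eq_sym.
Qed.

(** The set [closure_from b i] without the component of [i] is stable for [b].
    Removing it from [closure_from a i] leaves [i], hence leaves [j]; as [j] is in
    [closure_from b i], it belongs to the component of [i]. *)
Lemma below_two_labels a b i j : a != b -> inner a i -> inner b i ->
  i ~>_a j -> i ~>_b j -> j \in scc phi a i.
Proof.
move=> ab ai bi aij bij.
have [_ _ cC] := stableD ab (stable_closure_from (andP ai).2)
  (stable_closure_from_proper bi).
have /cC/(_ aij) : i \in closure_from a i :\: (closure_from b i :\: scc phi b i).
  by rewrite !in_setD mem_scc (inner_closure_from ai).
by rewrite !in_setD (scc_label_eq ai bi) !inE bij orbT andbT negbK => /andP[].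
Qed.

(** If [y] were outside [closure_from b x], then removing this set from
    [closure_from a y] would keep [y] but not [x], although [x] is reachable from
    [y].  So [y] lies in stable sets of both labels, and [scc_label_eq]
    applies. *)
Lemma label_swap a b x y : a != b -> inner a x -> inner b x -> inner a y ->
  y ~>_a x -> ~~ (x ~>_a y) ->
  [/\ inner b y, x ~>_b y & ~~ (y ~>_b x)].
Proof.
move=> ab ax bx ay yx nxy.
have ast := stable_closure_from (andP ay).2.
have bst := stable_closure_from (andP bx).2.
have yB : y \in closure_from b x.
  have [_ _ cC] := stableD ab ast bst.
  apply/negPn/negP => yB.
  have /cC/(_ yx) : y \in closure_from a y :\: closure_from b x.
    by rewrite in_setD yB inner_closure_from.
  by rewrite in_setD inner_closure_from.
have by_ : inner b y.
  by apply: stable_meet_inner bst ast yB (inner_closure_from ay); rewrite eq_sym.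
have xy : x ~>_b y by move: yB; rewrite inE (negbTE (andP by_).1).
split=> //; apply/negP => byx.
have : y \in scc phi b x by rewrite inE xy byx.
by rewrite -(scc_label_eq ax bx) inE (negbTE nxy).
Qed.

(** * The poset with inconsistent pairs *)

Local Notation pip := (pip phi).
Implicit Types p q r s : pip.

Lemma pip_inner p i : i \in (val p).1 ->
  inner (val p).2 i /\ (val p).1 = scc phi (val p).2 i.
Proof.
case: p => -[X a] /= /imsetP[j]; rewrite inE => aj -> ij.
by rewrite (scc_eq ij); split=> //; apply: inner_scc aj ij.
Qed.

Lemma pip_nonempty p : exists i, i \in (val p).1.
Proof. by case: p => -[X a] /= /imsetP[j _ ->]; exists j; apply: mem_scc. Qed.

Lemma inner_component a i : inner a i -> exists p, val p = (scc phi a i, a).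
Proof.
move=> ai; have aS : scc phi a i \in Sigma phi a.
  by apply/imsetP; exists i => //; rewrite inE.
by exists (Sub (scc phi a i, a) aS); rewrite SubK.
Qed.

Lemma pip_eq p q : (val p).1 = (val q).1 -> (val p).2 = (val q).2 -> p = q.
Proof. by move=> pq1 pq2; apply: val_inj; apply/eqP/andP; rewrite pq1 pq2 !eqxx. Qed.

Lemma pip_leE p q i j : i \in (val p).1 -> j \in (val q).1 ->
  pip_le p q = ((val p).2 == (val q).2) && (j ~>_((val p).2) i).
Proof.
move=> ip jq; rewrite /pip_le; case: eqP => //= pq.
have [_ pE] := pip_inner ip; have [_ qE] := pip_inner jq.
apply/exists_inP/idP => [[i' i'p /exists_inP[j' j'q]]|ji].
  move: i'p j'q; rewrite pE qE -pq !inE => /andP[_ i'i] /andP[jj' _] j'i'.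
  exact: reach_trans jj' (reach_trans j'i' i'i).
by exists i => //; apply/exists_inP; exists j.
Qed.

Lemma pip_isPIP : is_PIP (pip_le (phi := phi)) (pip_mic (phi := phi)).
Proof.
split.
- split.
  + by move=> p; have [i ip] := pip_nonempty p; rewrite (pip_leE ip ip) eqxx reach_refl.
  + move=> p q; have [i ip] := pip_nonempty p; have [j jq] := pip_nonempty q.
    rewrite (pip_leE ip jq) (pip_leE jq ip) => /andP[/andP[/eqP pq ji] /andP[_ ij]].
    apply: pip_eq => //; rewrite (pip_inner ip).2 (pip_inner jq).2 pq in ij ji *.
    by apply: scc_eq; rewrite inE ij ji.
  + move=> q p r; have [i ip] := pip_nonempty p; have [j jq] := pip_nonempty q.
    have [l lr] := pip_nonempty r.
    rewrite (pip_leE ip jq) (pip_leE jq lr) (pip_leE ip lr).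
    case/andP=> /eqP-> ji /andP[-> lj]; exact: reach_trans lj ji.
- by move=> p q; rewrite /pip_mic !(eq_sym (val q).1) !(eq_sym (val q).2).
- move=> p q /andP[/negP pq _] [r [/andP[/eqP pr _] /andP[/eqP qr _]]].
  by apply: pq; rewrite pr qr.
move=> p q p' q' p'p q'q /andP[ab /eqP X'E] /andP[_ /eqP XE].
have [i ip] := pip_nonempty p; have [j jp'] := pip_nonempty p'.
have iq : i \in (val q).1 by rewrite -XE.
have jq' : j \in (val q').1 by rewrite -X'E.
move: p'p q'q; rewrite (pip_leE jp' ip) (pip_leE jq' iq).
case/andP=> /eqP p'p aij /andP[/eqP q'q bij].
have [ai pE] := pip_inner ip; have [bi _] := pip_inner iq.
move: ab aij bij; rewrite p'p q'q => ab aij bij.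
have := below_two_labels ab ai bi aij bij => /scc_eq jE.
have p'E : (val p').1 = (val p).1.
  by rewrite (pip_inner jp').2 p'p jE.
by split; apply: pip_eq => //; rewrite -X'E -XE.
Qed.

Lemma pip_lt_labels p q : pip_lt (pip_le (phi := phi)) p q -> (val p).2 = (val q).2.
Proof. by case/andP=> _ /andP[/eqP]. Qed.

Lemma pip_lt_asym p q : pip_lt (pip_le (phi := phi)) p q ->
  ~~ pip_lt (pip_le (phi := phi)) q p.
Proof.
have [[_ anti _] _ _ _] := pip_isPIP.
case/andP=> pq lepq; apply: contra pq => /andP[_ leqp].
by apply/eqP/anti; rewrite lepq.
Qed.

Lemma pip_lt_swap p q r : pip_lt (pip_le (phi := phi)) p q ->
  (val r).1 = (val p).1 -> r != p ->
  exists s, [/\ (val s).1 = (val q).1, (val s).2 = (val r).2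
              & pip_lt (pip_le (phi := phi)) s r].
Proof.
move=> pq rp1 rp.
have rp2 : (val p).2 != (val r).2.
  by apply: contraNneq rp => ?; apply/eqP/pip_eq.
have [x xp] := pip_nonempty p; have [y yq] := pip_nonempty q.
have xr : x \in (val r).1 by rewrite rp1.
have pqE := pip_lt_labels pq; have /negP npq := pip_lt_asym pq.
have [ax _] := pip_inner xp; have [bx rE] := pip_inner xr.
have [ay qE] := pip_inner yq; rewrite -pqE in ay qE.
have yx : y ~>_((val p).2) x.
  by case/andP: pq => _; rewrite (pip_leE xp yq) => /andP[].
have nxy : ~~ (x ~>_((val p).2) y).
  apply/negP => xy; apply: npq; apply/andP; split.
    by rewrite eq_sym; case/andP: pq.
  by rewrite (pip_leE yq xp) -pqE eqxx.
have [bY xy nyx] := label_swap rp2 ax bx ay yx nxy.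
have [s sE] := inner_component bY.
have ys : y \in (val s).1 by rewrite sE mem_scc.
exists s; split;
  [by rewrite qE sE (scc_label_eq ay bY) | by rewrite sE | apply/andP; split].
  by apply: contraNneq nyx => sr; move: xr; rewrite -sr sE inE => /andP[].
by rewrite (pip_leE ys xr) sE eqxx.
Qed.

(** Swapping twice yields a cycle in the order if the component of [p] carries a
    third label.  So [p] and [r] are its only copies, and the copies of the other
    component carry the same two labels, with the order reversed. *)
Lemma pip_lt_two_labels p q r : pip_lt (pip_le (phi := phi)) p q ->
  (val r).1 = (val p).1 -> r != p ->
  exists s, (val s).1 = (val q).1 /\
    forall p' q', (val p').1 = (val p).1 -> p' != p ->
      (val q').1 = (val q).1 -> q' != s ->
      pip_lt (pip_le (phi := phi)) p q' /\ pip_lt (pip_le (phi := phi)) s p'.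
Proof.
move=> pq rp1 rp; have [s [sq1 sr2 sr]] := pip_lt_swap pq rp1 rp.
exists s; split; first exact: sq1.
have only_r p' : (val p').1 = (val p).1 -> p' != p -> p' = r.
  move=> p'p1 p'p; have [s' [s'q1 s'p'2 s'p']] := pip_lt_swap pq p'p1 p'p.
  have [ss'|s's] := eqVneq s' s.
    by apply: pip_eq; rewrite ?p'p1 // -s'p'2 ss'.
  have [|t [tr1 ts'2]] := pip_lt_swap sr _ s's; first by rewrite s'q1.
  have -> : t = p' by apply: pip_eq; rewrite ?tr1 ?p'p1 // ts'2.
  by rewrite (negbTE (pip_lt_asym s'p')).
move=> p' q' p'p1 p'p q'q1 q's; rewrite (only_r p') //; split; last exact: sr.
have [|t [tr1 tq'2 tq']] := pip_lt_swap sr _ q's; first by rewrite q'q1.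
have [<- //|tp] := eqVneq t p.
have tr : t = r by apply: only_r => //; rewrite tr1.
case/eqP: q's; apply: pip_eq; first by rewrite q'q1.
by rewrite sr2 -tq'2 tr.
Qed.

Lemma pip_elementary : elementary (pip_le (phi := phi)) (pip_mic (phi := phi)).
Proof.
(* One block for each vertex set; it is empty if the set is not a component. *)
pose B (i : 'I_#|{set 'I_n}|) : {set pip} :=
  [set p : pip | (val p).1 == enum_val i].
have BP i p q : p \in B i -> q \in B i -> (val q).1 = (val p).1.
  by rewrite !inE => /eqP-> /eqP->.
have Bother i p : (1 < #|B i|)%N -> p \in B i -> exists2 r, r \in B i & r != p.
  move=> Bi pB; have : (0 < #|B i :\ p|)%N by move: Bi; rewrite (cardsD1 p) pB.
  by case/card_gt0P => r; rewrite in_setD1 => /andP[? ?]; exists r.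
exists #|{set 'I_n}|, B; split.
- split=> [p|p q pq].
    exists (enum_rank (val p).1); split=> [|i].
      by rewrite inE enum_rankK.
    by rewrite inE => /eqP->; rewrite enum_valK.
  split=> [/andP[_ /eqP pq1]|[i [pi qi]]].
    by exists (enum_rank (val p).1); rewrite !inE enum_rankK -pq1 eqxx.
  apply/andP; rewrite (BP i p q) //; split=> //.
  by apply: contraNneq pq => pq2; apply/eqP/pip_eq => //; rewrite (BP i p q).
- move=> i j y ij Bi Bj [x [xi xy]]; have [r ri rx] := Bother i x Bi xi.
  have [s [sy1 sr2 _]] := pip_lt_swap xy (BP _ _ _ xi ri) rx.
  have : s \in B j.
    by have : y \in B j by [rewrite Bj set11]; rewrite !inE sy1.
  rewrite Bj in_set1 => /eqP sy; case/eqP: rx; apply: pip_eq; first exact: BP ri.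
  by rewrite -sr2 sy (pip_lt_labels xy).
move=> i j ij Bi Bj.
have sep x y : x \in B i -> y \in B j -> x != y.
  rewrite !inE => /eqP xi /eqP yj; apply: contraNneq ij => xy.
  by apply/eqP/enum_val_inj; rewrite -xi -yj xy.
case: (boolP [exists x in B i, exists y in B j, pip_le x y || pip_le y x]).
  case/exists_inP=> x xi /exists_inP[y yj /orP[lexy|leyx]]; right.
    have xy : pip_lt (pip_le (phi := phi)) x y by rewrite /pip_lt sep.
    have [r ri rx] := Bother i x Bi xi.
    have [s [sy1 sP]] := pip_lt_two_labels xy (BP _ _ _ xi ri) rx.
    exists x, s; split; [exact: xi | by move: yj; rewrite !inE sy1 |].
    move=> x' y' x'i x'x y'j y's.
    exact: sP (BP _ _ _ xi x'i) x'x (BP _ _ _ yj y'j) y's.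
  have yx : pip_lt (pip_le (phi := phi)) y x by rewrite /pip_lt eq_sym sep.
  have [r rj ry] := Bother j y Bj yj.
  have [s [sx1 sP]] := pip_lt_two_labels yx (BP _ _ _ yj rj) ry.
  exists s, y; split; [by move: xi; rewrite !inE sx1 | exact: yj |].
  move=> x' y' x'i x's y'j y'y; apply/and_comm.
  exact: sP (BP _ _ _ yj y'j) y'y (BP _ _ _ xi x'i) x's.
move/exists_inPn => nle; left=> x y xi yj.
by have /exists_inPn/(_ y yj) := nle x xi; rewrite negb_or => /andP[].
Qed.

(** * Semi-multicuts as disjoint parts *)

Local Notation multicut := {ffun Sk k -> {set vertex}}.
Implicit Types (X Y : multicut) (U : 'I_k -> {set 'I_n}) (I J : {set pip}).

Definition label_part X a : {set 'I_n} := [set i | orig g gamma i \in X (lab a)].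

Definition disjoint_parts U : Prop :=
  forall a b i, i \in U a -> i \in U b -> a = b.

Definition multicut_of U : multicut :=
  [ffun j : Sk k => if unlift ord0 j is Some a then to_cut g gamma a (U a)
                    else ~: (\bigcup_(a < k) to_cut g gamma a (U a))].

Lemma multicut_of_lab U a : multicut_of U (lab a) = to_cut g gamma a (U a).
Proof. by rewrite ffunE liftK. Qed.

Lemma multicut_of_ord0 U :
  multicut_of U ord0 = ~: (\bigcup_(a < k) to_cut g gamma a (U a)).
Proof. by rewrite ffunE unlift_none. Qed.

Lemma label_part_multicut_of U a : label_part (multicut_of U) a = U a.
Proof. by apply/setP => i; rewrite inE multicut_of_lab inE. Qed.

Lemma eq_multicut_of U1 U2 : U1 =1 U2 -> multicut_of U1 = multicut_of U2.
Proof.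
move=> E; apply/ffunP => j; rewrite !ffunE; case: unliftP => [a|] _.
  by rewrite E.
by congr (~: _); apply: eq_bigr => a _; rewrite E.
Qed.

Lemma admissible_multicut_of U : disjoint_parts U -> admissible_smc (multicut_of U).
Proof.
move=> Udisj.
have cut_disj a b v : v \in to_cut g gamma a (U a) ->
    v \in to_cut g gamma b (U b) -> a = b.
  case: v => [[i|c]|f]; rewrite !inE; first exact: Udisj.
    by move=> /eqP <- /eqP.
  by move=> /andP[_ fa] /andP[_]; apply: Udisj.
split; first split.
- move=> v; have [/bigcupP[a _ va]|vN] :=
    boolP (v \in \bigcup_(a < k) to_cut g gamma a (U a)).
    exists (lab a); split=> [|j]; first by rewrite multicut_of_lab.
    case: (unliftP ord0 j) => [b ->|->]; last first.
      rewrite multicut_of_ord0 in_setC => /negP[].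
      by apply/bigcupP; exists a.
    by rewrite multicut_of_lab => vb; rewrite (cut_disj _ _ _ va vb).
  exists ord0; split=> [|j]; first by rewrite multicut_of_ord0 in_setC.
  case: (unliftP ord0 j) => [b ->|-> //].
  rewrite multicut_of_lab => vb; have /negP[] := vN.
  by apply/bigcupP; exists b.
- move=> a; rewrite multicut_of_lab.
  by have [[[] ]] := (to_cutP a (U a) (to_cut g gamma a (U a))).2 erefl.
move=> f; split=> [|b bf].
  rewrite in_setU multicut_of_ord0 multicut_of_lab !in_setC => fU.
  apply/bigcupP => -[a _]; rewrite inE /= => /andP[fa fUa].
  case/orP: fU => [/bigcupP[]|]; first by exists a; rewrite // inE.
  by rewrite inE /= => fUf; rewrite (Udisj _ _ _ fUf fUa) eqxx in fa.
by rewrite multicut_of_lab !inE /= eq_sym bf.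
Qed.

Lemma admissible_label_cut X a :
  admissible_smc X -> X (lab a) = to_cut g gamma a (label_part X a).
Proof.
move=> [[Xpart Xcut] Xfr]; apply/to_cutP; split; last by move=> i; rewrite inE.
split=> // f fa; have [ffree fbound] := Xfr f; split=> [fX|]; last first.
  by apply: fbound; rewrite eq_sym.
have Xuniq v j j' : v \in X j -> v \in X j' -> j = j'.
  by have [l [_ lU]] := Xpart v => vj vj'; rewrite -(lU j vj) -(lU j' vj').
have [j [fj _]] := Xpart (orig g gamma (fbase f)).
have f0 : orig g gamma (fbase f) \in X ord0 :|: X (lab (flabel f)) -> lab a = ord0.
  by move=> /ffree; apply: Xuniq.
case: (unliftP ord0 j) fj => [b ->|->] fj; last first.
  by have := f0 _; rewrite in_setU fj => /(_ isT).
have [bf|bf] := eqVneq b (flabel f).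
  by have := f0 _; rewrite in_setU -bf fj orbT => /(_ isT).
by rewrite (Xuniq _ _ _ fX (fbound b bf fj)).
Qed.

Lemma admissible_disjoint_parts X : admissible_smc X -> disjoint_parts (label_part X).
Proof.
move=> [[Xpart _] _] a b i; rewrite !inE => ia ib.
have [l [_ lU]] := Xpart (orig g gamma i).
by apply: (@lift_inj _ ord0); rewrite -(lU _ ia) -(lU _ ib).
Qed.

Lemma admissible_multicutE X : admissible_smc X -> X = multicut_of (label_part X).
Proof.
move=> Xadm; apply/ffunP => j; case: (unliftP ord0 j) => [a ->|->].
  by rewrite multicut_of_lab; apply: admissible_label_cut.
rewrite multicut_of_ord0; apply/setP => v; rewrite in_setC.
have [[Xpart _] _] := Xadm; have [l [vl lU]] := Xpart v.
apply/idP/idP => [v0|vN].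
  apply/bigcupP => -[a _]; rewrite -admissible_label_cut // => /lU la.
  by have := lU _ v0; rewrite la.
case: (unliftP ord0 l) vl => [a ->|-> //] va; have /negP[] := vN.
by apply/bigcupP; exists a; rewrite // -admissible_label_cut.
Qed.

Lemma smc_cap_admissible X : admissible_smc X ->
  smc_cap e lam X = 2^-1 * \sum_(a < k) label_cut a (label_part X a).
Proof.
move=> Xadm; congr (_ * _); apply: eq_bigr => a _.
by rewrite admissible_label_cut.
Qed.

(** The least stable sets of the labels are pairwise disjoint, so they form an
    admissible semi-multicut whose parts all minimize their own label cut.  A
    minimum can thus be tested label by label. *)
Lemma min_admissible_smcP X :
  min_admissible_smc e lam X <->
  admissible_smc X /\ forall a, stable a (label_part X a).
Proof.
pose U0 a := [set i | src a i].
have U0disj : disjoint_parts U0.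
  move=> a b i ia ib; apply/eqP/negPn/negP => ab.
  have /negP[] := stable_not_src ab (stable_src a) ia.
  by move: ib; rewrite inE.
have U0opt a : optimal a (U0 a) by apply/optimal_stable/stable_src.
split=> [[Xadm Xmin]|[Xadm Xst]]; last first.
  split=> // Y Yadm; rewrite !smc_cap_admissible // ler_wpM2l ?invr_ge0 //.
  by apply: ler_sum => a _; exact: (optimal_stable _ _).2 (Xst a) _.
split=> // a; apply/optimal_stable => B; apply: le_trans (U0opt a B).
have := Xmin _ (admissible_multicut_of U0disj).
rewrite !smc_cap_admissible //; last exact: admissible_multicut_of.
rewrite ler_pM2l ?invr_gt0 // -subr_ge0 -sumrB (bigD1 a) //= label_part_multicut_of.
move=> sum_ge0; rewrite -subr_ge0; apply: le_trans sum_ge0 _.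
rewrite gerDl; apply: sumr_le0 => b _.
by rewrite label_part_multicut_of subr_le0; apply: U0opt.
Qed.

(** * From ideals to minimum semi-multicuts *)

Definition ideal_part I a : {set 'I_n} :=
  [set i | src a i || [exists p in I, ((val p).2 == a) && (i \in (val p).1)]].

Lemma ideal_smcE I : ideal_smc I = multicut_of (ideal_part I).
Proof. by []. Qed.

Local Notation consistent :=
  (consistent_ideal (pip_le (phi := phi)) (pip_mic (phi := phi))).

Lemma mem_ideal_part I p i :
  i \in (val p).1 -> (i \in ideal_part I (val p).2) = (p \in I).
Proof.
move=> ip; have [/andP[si _] pE] := pip_inner ip.
rewrite inE (negbTE si) /=; apply/exists_inP/idP => [[q qI /andP[/eqP qp iq]]|pI].
  suff -> : p = q by [].
  by apply: pip_eq => //; rewrite pE (pip_inner iq).2 qp.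
by exists p; rewrite // eqxx.
Qed.

Lemma inner_mem_ideal_part I a i : inner a i -> i \in ideal_part I a ->
  exists2 p, p \in I & (val p).2 = a /\ i \in (val p).1.
Proof.
move=> /andP[si _]; rewrite inE (negbTE si) /= => /exists_inP[p pI /andP[/eqP pa ip]].
by exists p.
Qed.

Lemma ideal_part_stable I a : consistent I -> stable a (ideal_part I a).
Proof.
move=> [Iideal _]; have [_ srcN srcC] := stable_src a.
split=> [i|i|i j]; rewrite !inE; first by move=> ->.
  case/orP => [si|]; first by apply: srcN; rewrite inE.
  by case/exists_inP => p pI /andP[/eqP <-] /pip_inner[/andP[]].
case/orP => [si|/exists_inP[p pI /andP[/eqP <- ip]]] ij.
  by have := srcC i j; rewrite !inE => ->.
have [/andP[_ ti] pE] := pip_inner ip.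
case: (boolP (src _ j)) => //= sj.
have aj : inner (val p).2 j.
  by rewrite /inner sj; apply: contra ti; apply: reach_trans ij.
have [q qE] := inner_component aj.
have jq : j \in (val q).1 by rewrite qE mem_scc.
apply/exists_inP; exists q; last by rewrite jq qE eqxx.
by apply: Iideal pI _; rewrite (pip_leE jq ip) qE eqxx.
Qed.

(** A vertex common to two parts would put the same component into the ideal with
    two labels. *)
Lemma ideal_part_disjoint I : consistent I -> disjoint_parts (ideal_part I).
Proof.
move=> Icons a b i ia ib; apply/eqP/negPn/negP => ab.
have ast := ideal_part_stable a Icons; have bst := ideal_part_stable b Icons.
have ai := stable_meet_inner ab ast bst ia ib.
have bi : inner b i by apply: stable_meet_inner bst ast ib ia; rewrite eq_sym.
have [p pI [pa ip]] := inner_mem_ideal_part ai ia.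
have [q qI [qb iq]] := inner_mem_ideal_part bi ib.
have /negP[] := Icons.2 _ _ pI qI.
apply/andP; rewrite pa qb; split=> //.
by rewrite (pip_inner ip).2 (pip_inner iq).2 pa qb (scc_label_eq ai bi).
Qed.

Lemma ideal_smc_min I : consistent I -> min_admissible_smc e lam (ideal_smc I).
Proof.
move=> Icons; apply/min_admissible_smcP; split.
  exact/admissible_multicut_of/ideal_part_disjoint.
by move=> a; rewrite label_part_multicut_of; apply: ideal_part_stable.
Qed.

Lemma ideal_smc_inj : injective (ideal_smc (phi := phi)).
Proof.
move=> I J IJ; apply/setP => p; have [i ip] := pip_nonempty p.
rewrite -!(mem_ideal_part _ ip) -![ideal_part _ _]label_part_multicut_of.
by rewrite -!ideal_smcE IJ.
Qed.

Lemma ideal_smc_surj X : min_admissible_smc e lam X ->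
  exists2 I, consistent I & ideal_smc I = X.
Proof.
move=> /min_admissible_smcP[Xadm Xst]; have Xdisj := admissible_disjoint_parts Xadm.
pose I : {set pip} := [set p : pip | (val p).1 \subset label_part X (val p).2].
have memI p i : i \in (val p).1 -> i \in label_part X (val p).2 -> p \in I.
  move=> ip iX; rewrite inE (pip_inner ip).2; apply/subsetP => j.
  rewrite inE => /andP[ij _]; have [_ _ Xcl] := Xst (val p).2.
  exact: Xcl iX ij.
have Isub p i : p \in I -> i \in (val p).1 -> i \in label_part X (val p).2.
  by rewrite inE => /subsetP sub /sub.
exists I.
  split=> [p q qI pq|p q pI qI].
    have [i ip] := pip_nonempty p; have [j jq] := pip_nonempty q.
    move: pq; rewrite (pip_leE ip jq) => /andP[/eqP pq2 ji].
    apply: (memI p i) => //; have [_ _ Xcl] := Xst (val p).2.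
    by apply: Xcl ji; rewrite pq2; apply: Isub.
  apply/andP => -[/eqP pq2 /eqP pq1]; have [i ip] := pip_nonempty p.
  apply: pq2; apply: Xdisj (Isub _ _ pI ip) (Isub _ _ qI _).
  by rewrite -pq1.
rewrite ideal_smcE [RHS](admissible_multicutE Xadm); apply: eq_multicut_of => a.
have [Xsrc Xsnk _] := Xst a.
apply/setP => i; apply/idP/idP => [|iX].
  rewrite inE => /orP[/Xsrc //|/exists_inP[p pI /andP[/eqP <-]]].
  exact: Isub.
have [si|si] := boolP (src a i); first by rewrite inE si.
have [p pE] : exists p, val p = (scc phi a i, a).
  by apply: inner_component; rewrite /inner si Xsnk.
have ip : i \in (val p).1 by rewrite pE mem_scc.
have aE : a = (val p).2 by rewrite pE.
by rewrite aE (mem_ideal_part _ ip); apply: (memI p i) => //; rewrite -aE.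
Qed.

End Cuts.

From mathcomp Require Import boolp classical_sets functions reals.

Theorem theorem23 (R : realType) (k n : nat)
    (e : rel 'I_n) (lam : 'I_n -> 'I_n -> R) (g : 'I_n -> Sk k -> R)
    (gt : {ffun 'I_n -> Sk k} -> R)
    (hg : potts_ksubmodular e lam g gt)
    (gamma : 'I_n -> Sk k)
    (hgamma : forall (i : 'I_n) (a : Sk k), g i (gamma i) <= g i a)
    (phi : forall a : 'I_k, narc e lam g gamma a -> R)
    (hphi : forall a : 'I_k, max_label_flow (phi a)) :
  [/\ is_PIP (pip_le (phi := phi)) (pip_mic (phi := phi)),
      elementary (pip_le (phi := phi)) (pip_mic (phi := phi))
    & set_bij (consistent_ideal (pip_le (phi := phi)) (pip_mic (phi := phi)))
              (min_admissible_smc e lam (g := g) (gamma := gamma))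
              (ideal_smc (phi := phi))].
Proof.
split.
- exact (pip_isPIP hg hgamma hphi).
- exact (pip_elementary hg hgamma hphi).
split.
- move=> I Icons; exact (ideal_smc_min hg hgamma hphi Icons).
- move=> I J _ _; exact (@ideal_smc_inj _ _ _ _ _ _ _ phi I J).
move=> X Xmin; have [I Icons <-] := ideal_smc_surj hg hgamma hphi Xmin.
by exists I.
Qed.
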